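(* For every function $f:\mathbb{N}\to\mathbb{N}$ there is a function $g:\mathbb{N}\to\mathbb{N}$ such that for every integer $k\geq 1$, every graph $\Gamma=(V,E)$ of valency $k$, every finite group $G$ acting vertex-transitively on $\Gamma$, and every $v\in V$: if $\lambda_2<f(k)$, then $|G_v|<g(k)$. Conversely, for every function $g:\mathbb{N}\to\mathbb{N}$ there is a function $f:\mathbb{N}\to\mathbb{N}$ such that for every integer $k\geq 1$, every graph $\Gamma=(V,E)$ of valency $k$, every finite group $G$ acting vertex-transitively on $\Gamma$, and every $v\in V$: if $|G_v|<g(k)$, then $\lambda_2<f(k)$. Here $\lambda_2$ denotes the second largest singular value (counted with multiplicity) of the $V\times V$ matrix $\mathcal{A}$ with entries $\mathcal{A}(x,y)=|\{s\in S: s(x)=y\}|$, where $S=\{g\in G: g(v)\in\Gamma(v)\}$.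
   Context: Graphs are simple and undirected. A finite group $G$ acts vertex-transitively on a graph $\Gamma=(V,E)$ if it acts on $V$ preserving adjacency and is transitive on $V$; in particular $V$ is finite. The graph has valency $k$ if every vertex has exactly $k$ neighbours. $\Gamma(v)$ denotes the set of neighbours of the vertex $v$, and $G_v$ the stabilizer of $v$ in $G$. $\mathbb{N}=\{1,2,3,\dots\}$. For a vertex $v$, let $S=\{g\in G: g(v)\in\Gamma(v)\}$. Then $S$ is a union of double cosets of $G_v$ in $G$ with $S=S^{-1}$, and $\Gamma$ is isomorphic to the coset graph $\mathrm{Cos}(G,G_v,S)$, whose vertices are the left cosets of $G_v$ in $G$ and whose edges are the pairs $\{xG_v,yG_v\}$ with $G_vx^{-1}yG_v\subset S$. The associated bipartite multigraph $\mathcal{G}$ has as its two vertex classes two copies $X,Y$ of $V$, and the number of edges between $x\in X$ and $y\in Y$ is the number of $s\in S$ with $s(x)=y$. The matrix $\mathcal{A}$, with rows indexed by $X$ and columns by $Y$ and with $\mathcal{A}(x,y)$ equal to the number of edges between $x$ and $y$, is its bipartite adjacency matrix. Its singular values are listed with multiplicity in non-increasing order $\lambda_1\geq\lambda_2\geq\cdots\geq 0$ (there are $|V|$ of them). Replacing $v$ by another vertex replaces $S$ by a conjugate and does not change the singular values. *)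

(* Defs.v *)
From mathcomp Require Import all_boot all_order all_fingroup all_algebra.

Set Implicit Arguments.
Unset Strict Implicit.
Unset Printing Implicit Defensive.

Import Order.TTheory GRing.Theory Num.Theory.
Local Open Scope ring_scope.
Local Open Scope sesquilinear_scope.

(* The natural numbers start at 1. *)
Definition pos_nat := {n : nat | (0 < n)%N}.
Coercion nat_of_pos_nat (n : pos_nat) : nat := sval n.

Definition simple_graph (V : finType) (e : rel V) : Prop :=
  symmetric e /\ irreflexive e.

Definition neighbours (V : finType) (e : rel V) (v : V) : {set V} :=
  [set w | e v w].

Definition has_valency (V : finType) (e : rel V) (k : nat) : Prop :=
  forall v : V, #|neighbours e v| = k.

(* Actions are not assumed to be faithful. They are on the right, [to x g]
   being the image of x under g; a left action g(x) corresponds to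
   [to x g := g^-1(x)]. Passing from one to the other replaces the set
   S = {g : g(v) adjacent to v} by S^-1, which is S itself, and leaves the
   number of s in S sending x to y unchanged. *)
Definition acts_vertex_transitively (gT : finGroupType) (G : {group gT})
    (V : finType) (e : rel V) (to : action G V) : Prop :=
  {in G, forall g x y, e (to x g) (to y g) = e x y} /\
  [transitive G, on [set: V] | to].

Definition neighbour_movers (gT : finGroupType) (G : {group gT})
    (V : finType) (e : rel V) (to : action G V) (v : V) : {set gT} :=
  [set g in G | to v g \in neighbours e v].

Definition edge_multiplicity (gT : finGroupType) (G : {group gT})
    (V : finType) (to : action G V) (S : {set gT}) (x y : V) : nat :=
  #|[set s in S | to x s == y]|.

Definition biadjacency_mx (C : numClosedFieldType) (gT : finGroupType)
    (G : {group gT}) (V : finType) (to : action G V) (S : {set gT}) :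
    'M[C]_#|V| :=
  \matrix_(i, j) (edge_multiplicity to S (enum_val i) (enum_val j))%:R.

Lemma gram_normalmx (C : numClosedFieldType) n (A : 'M[C]_n) :
  A *m A ^t* \is normalmx.
Proof.
apply/normalmxP.
by rewrite trmx_mul map_mxM /= trmxCK.
Qed.

(* [spectral_diag B] lists the eigenvalues of a normal matrix B with
   multiplicity, and A *m A ^t* is normal by [gram_normalmx]. The order on C is
   only partial, but the numbers sorted here are real and nonnegative. *)
Definition singular_values (C : numClosedFieldType) n (A : 'M[C]_n) : seq C :=
  sort >=%R [seq sqrtC (spectral_diag (A *m A ^t*) 0 i) | i : 'I_n].

(* Sequences are numbered from 0. The default 0 is never used below: a graph of
   valency at least 1 has at least two vertices. *)
Definition lambda2 (C : numClosedFieldType) n (A : 'M[C]_n) : C :=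
  (singular_values A)`_1.

(* Main.v *)
(* Let H = G_v and n = |V|. Every row and column of the matrix has sum
   |S| = k|H|, so every singular value is at most k|H|, which settles the
   converse. For the direct part, the all-ones vector is a singular vector for
   k|H|, so if lambda_2 < c then all entries of the matrix are within c of
   k|H|/n, as in the expander mixing lemma. The entry at (v, y) with y adjacent
   to v is |H|, and n > k, so |H| <= c (k + 1). *)
Require Import Defs.
From mathcomp Require Import all_boot all_order all_fingroup all_algebra.
From mathcomp Require Import ring.

Set Implicit Arguments.
Unset Strict Implicit.
Unset Printing Implicit Defensive.

Import Order.TTheory GRing.Theory Num.Theory.

(** * Singular values of a square matrix and the mixing inequality *)

Section SingularValues.

Local Open Scope ring_scope.
Local Open Scope sesquilinear_scope.

Variables (C : numClosedFieldType) (n : nat).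
Implicit Types (A : 'M[C]_n) (u w : 'rV[C]_n) (c mu r : C).

Lemma mulmx_trmxC_diag m (B : 'M[C]_(m, n)) i :
  (B *m B ^t*) i i = \sum_j `|B i j| ^+ 2.
Proof. by rewrite mxE; apply: eq_bigr => j _; rewrite !mxE normCK. Qed.

Lemma spectralmx_gram A :
  spectralmx (A *m A ^t*) *m (A *m A ^t*)
    = diag_mx (spectral_diag (A *m A ^t*)) *m spectralmx (A *m A ^t*).
Proof.
have /orthomx_spectralP {2}-> := gram_normalmx A.
by rewrite !mulmxA mulmxV ?spectral_unit // mul1mx.
Qed.

(** After diagonalising by the unitary [P], the eigenvalue at [i] is the squared norm of row [i] of
    [P *m A]. *)
Lemma spectral_diag_gram_ge0 A i : 0 <= spectral_diag (A *m A ^t*) 0 i.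
Proof.
set P := spectralmx (A *m A ^t*); set d := spectral_diag _.
have Pu : P *m P ^t* = 1%:M by apply/unitarymxP/spectral_unitarymx.
have PD : (P *m A) *m (P *m A) ^t* = diag_mx d.
  rewrite trmx_mul map_mxM /= mulmxA -(mulmxA P) spectralmx_gram.
  by rewrite -mulmxA Pu mulmx1.
have := mulmx_trmxC_diag (P *m A) i; rewrite PD mxE eqxx mulr1n => ->.
by apply: sumr_ge0 => j _; rewrite exprn_ge0.
Qed.

Lemma singular_values_ge0 A : all (fun x => 0 <= x) (singular_values A).
Proof.
rewrite all_sort; apply/allP=> _ /mapP[i _ ->].
by rewrite sqrtC_ge0 spectral_diag_gram_ge0.
Qed.

(** The order on [C] is only partial, but it is total on nonnegative elements, and that is enough
    for [sort]. *)
Lemma singular_values_sorted A : sorted >=%R (singular_values A).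
Proof.
apply: (@sort_sorted_in _ (fun x => 0 <= x)); last first.
  by have := singular_values_ge0 A; rewrite all_sort.
move=> x y; rewrite -!topredE /= => x0 y0.
exact: real_leVge (ger0_real y0) (ger0_real x0).
Qed.

Lemma lambda2_le A c :
  0 <= c -> (forall i, spectral_diag (A *m A ^t*) 0 i <= c ^+ 2) ->
  lambda2 A <= c.
Proof.
move=> c0 dc; rewrite /lambda2.
(* With fewer than two singular values, [lambda2 A] is the default 0. *)
have [s1|s1] := ltnP 1 (size (singular_values A));
  last by rewrite nth_default.
have: (singular_values A)`_1 \in singular_values A by exact: mem_nth.
rewrite mem_sort => /mapP[i _ ->].
rewrite -(sqrCK c0).
by rewrite ler_sqrtC ?nnegrE ?dc ?spectral_diag_gram_ge0 ?exprn_ge0.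
Qed.

(** Indices correspond to entries of the sorted list with multiplicity. All entries from the second
    on are at most [lambda2 A < c], so at most one entry reaches [c]. *)
Lemma lambda2_lt_inj A c i j :
  0 <= c -> lambda2 A < c ->
  c ^+ 2 <= spectral_diag (A *m A ^t*) 0 i ->
  c ^+ 2 <= spectral_diag (A *m A ^t*) 0 j -> i = j.
Proof.
move=> c0 l2 ci cj.
set P := fun x : C => c <= x.
pose Q := [pred i | P (sqrtC (spectral_diag (A *m A ^t*) 0 i))].
have QE k : c ^+ 2 <= spectral_diag (A *m A ^t*) 0 k -> k \in Q.
  move=> ck; rewrite inE /= /P -(sqrCK c0).
  by rewrite ler_sqrtC ?nnegrE ?spectral_diag_gram_ge0 ?exprn_ge0.
suff /card_le1_eqP Q1 : (#|Q| <= 1)%N by apply: Q1; apply: QE.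
have -> : #|Q| = count P (singular_values A).
  rewrite /singular_values count_sort count_map cardE size_filter /=.
  by rewrite -enumT.
have := singular_values_sorted A; move: l2; rewrite /lambda2.
case: (singular_values A) => [|x [|y s]] //=; first by case: (P x).
move=> yc /andP[_ sy].
have Py z : z <= y -> P z = false.
  move=> zy; apply/negP => cz.
  by have := lt_le_trans yc (le_trans cz zy); rewrite ltxx.
have /allP sy' : all (fun z => z <= y) s.
  by apply: order_path_min sy => a b d ba; move/le_trans; apply.
rewrite (Py y) //= add0n (_ : count P s = 0%N) ?addn0; first by case: (P x).
by apply/eqP; rewrite -leqn0 leqNgt -has_count; apply/hasPn => z /sy' /Py ->.
Qed.

(* Only one eigenvalue of A *m A ^t* is at least c ^+ 2, and it belongs to u, so
   w has no component along it. *)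
Lemma sqnorm_mulmx_le A u w mu c :
  u != 0 -> u *m (A *m A ^t*) = mu *: u -> w *m u ^t* = 0 ->
  0 <= c -> c ^+ 2 <= mu -> lambda2 A < c ->
  \sum_j `|(w *m A) 0 j| ^+ 2 <= c ^+ 2 * \sum_j `|w 0 j| ^+ 2.
Proof.
move=> u0 uA wu c0 cmu l2.
set N := A *m A ^t*; set P := spectralmx N; set d := spectral_diag N.
have Pu : P \is unitarymx by exact: spectral_unitarymx.
have NE : N = P ^t* *m diag_mx d *m P.
  by rewrite -invmx_unitary //; apply/orthomx_spectralP/gram_normalmx.
(* Coordinates of [u] and [w] in the orthonormal eigenbasis given by the rows of [P]. *)
set y := u *m P ^t*; set z := w *m P ^t*.
have yE : y *m diag_mx d = mu *: y.
  rewrite /y scalemxAl -uA -/N NE !mulmxA.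
  by rewrite mulmxtVK.
have uyP : u = y *m P by rewrite /y mulmxKtV.
have wzP : w = z *m P by rewrite /z mulmxKtV.
clearbody y z.
have y_neq0 : y != 0 by apply: contraNneq u0 => y0; rewrite uyP y0 mul0mx.
have /rV0Pn[i0 yi0] := y_neq0.
(* An eigenvector for [mu] is supported on indices with eigenvalue [mu]. As [c ^+ 2 <= mu], the only
   such index is [i0]. *)
have yd i : y 0 i != 0 -> d 0 i = mu.
  move=> yi; have /rowP/(_ i) := yE.
  by rewrite mul_mx_diag !mxE mulrC => /(mulIf yi).
have i0_uniq i : c ^+ 2 <= d 0 i -> i = i0.
  by move=> ci; apply: (lambda2_lt_inj c0 l2 ci); rewrite yd.
(* Since [y] is supported at [i0] alone, the inner product of [w] and [u] reduces to its single term
   at [i0]. *)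
have zi0 : z 0 i0 = 0.
  have: z *m y ^t* = 0.
    by rewrite -wu wzP uyP trmx_mul map_mxM /= !mulmxA mulmxtVK //.
  move/matrixP/(_ 0 0); rewrite !mxE (bigD1 i0) //= big1 => [|i ii0].
    rewrite addr0 !mxE => /eqP; rewrite mulf_eq0 conjC_eq0 (negPf yi0) orbF.
    by move/eqP.
  rewrite !mxE; have [->|/yd di] := eqVneq (y 0 i) 0.
    by rewrite conjC0 mulr0.
  by case/eqP: ii0; apply: i0_uniq; rewrite di.
(* The squared norm of [w *m A] is the quadratic form of [N] at [w], which is diagonal in the
   eigenbasis. *)
have -> : \sum_j `|(w *m A) 0 j| ^+ 2 = \sum_i d 0 i * `|z 0 i| ^+ 2.
  rewrite -mulmx_trmxC_diag trmx_mul map_mxM /= !mulmxA -(mulmxA w) -/N NE.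
  rewrite wzP trmx_mul map_mxM /= !mulmxA !mulmxtVK //.
  rewrite mxE; apply: eq_bigr => i _.
  by rewrite mul_mx_diag !mxE normCK mulrA (mulrC (d 0 i)).
have -> : \sum_j `|w 0 j| ^+ 2 = \sum_i `|z 0 i| ^+ 2.
  by rewrite -!mulmx_trmxC_diag {1 2}wzP trmx_mul map_mxM /= !mulmxA mulmxtVK //.
rewrite mulr_sumr; apply: ler_sum => i _.
have [->|zi] := eqVneq (z 0 i) 0; first by rewrite normr0 expr0n !mulr0.
apply: ler_wpM2r; first by rewrite exprn_ge0.
have /orP[//|/i0_uniq ii0] : (d 0 i <= c ^+ 2) || (c ^+ 2 <= d 0 i).
  apply: real_leVge; apply: ger0_real; last by rewrite exprn_ge0.
  exact: spectral_diag_gram_ge0.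
by rewrite ii0 zi0 eqxx in zi.
Qed.

(* The spectrum is bounded by the l^1 operator norm, acting on rows. *)
Lemma spectral_diag_gram_le A r i :
  (forall x y, 0 <= A x y) ->
  (forall x, \sum_y A x y = r) -> (forall y, \sum_x A x y = r) ->
  spectral_diag (A *m A ^t*) 0 i <= r ^+ 2.
Proof.
move=> A0 rowA colA.
set N := A *m A ^t*; set P := spectralmx N; set d := spectral_diag N.
have NE x y : N x y = \sum_j A x j * A y j.
  by rewrite mxE; apply: eq_bigr => j _; rewrite !mxE geC0_conj.
have N0 x y : 0 <= N x y by rewrite NE sumr_ge0 // => j _; rewrite mulr_ge0.
have rowN x : \sum_y N x y = r ^+ 2.
  under eq_bigr do rewrite NE.
  rewrite exchange_big /=.
  by under eq_bigr do rewrite -mulr_sumr colA; rewrite -mulr_suml rowA.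
set p := row i P.
have pE : p *m N = d 0 i *: p.
  by rewrite -row_mul spectralmx_gram row_mul row_diag_mx -scalemxAl -rowE.
have p0 : 0 < \sum_j `|p 0 j|.
  rewrite lt_def sumr_ge0 // andbT psumr_neq0 //.
  have : p != 0.
    apply: contraTneq isT => p0.
    have /row_unitarymxP/(_ i i) := spectral_unitarymx N.
    by rewrite -/P -/p p0 linear0l eqxx => /eqP; rewrite eq_sym oner_eq0.
  case/rV0Pn => j pj; apply/hasP; exists j; first exact: mem_index_enum.
  by rewrite /= normr_gt0.
(* Compare the l^1 norms of both sides of [pE]: the nonnegative matrix [N], with row sums [r ^+ 2],
   multiplies that of [p] by at most [r ^+ 2]. *)
rewrite -(ler_pM2r p0) mulr_sumr.
apply: (@le_trans _ _ (\sum_j \sum_x `|p 0 x| * N x j)).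
  apply: ler_sum => j _.
  rewrite -[d 0 i]ger0_norm ?spectral_diag_gram_ge0 // -normrM.
  have /rowP/(_ j) := pE; rewrite [RHS]mxE => <-; rewrite mxE.
  apply: le_trans (ler_norm_sum _ _ _) _; apply: ler_sum => x _.
  by rewrite normrM (ger0_norm (N0 _ _)).
rewrite exchange_big /= mulr_sumr; apply: ler_sum => x _.
by rewrite -mulr_sumr rowN mulrC.
Qed.

(* The expander mixing lemma for a pair of singletons. *)
Lemma lambda2_mixing A r c i j :
  (forall x, \sum_y A x y = r) -> (forall y, \sum_x A x y = r) ->
  0 <= c -> c <= r -> lambda2 A < c -> `|A i j - r / n%:R| <= c.
Proof.
move=> rowA colA c0 cr l2.
have r0 : 0 <= r := le_trans c0 cr.
have n0 : n%:R != 0 :> C.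
  by rewrite pnatr_eq0 -lt0n; apply: leq_ltn_trans (ltn_ord i).
pose u : 'rV[C]_n := const_mx 1.
have u0 : u != 0 by apply/rV0Pn; exists i; rewrite mxE oner_eq0.
have uA : u *m A = r *: u.
  apply/rowP => y; rewrite !mxE mulr1 -(colA y).
  by apply: eq_bigr => x _; rewrite mxE mul1r.
have uAt : u *m A ^t* = r *: u.
  apply/rowP => x; rewrite !mxE mulr1 -(geC0_conj r0) -(rowA x) rmorph_sum.
  by apply: eq_bigr => y _; rewrite !mxE mul1r.
have ut y : u ^t* y 0 = 1 by rewrite !mxE conjC1.
(* The projection of the [i]-th basis vector to the orthogonal complement of the all-ones vector
   [u]; its squared norm is [1 - 1/n]. *)
pose w := delta_mx 0 i - n%:R^-1 *: u.
have wu : w *m u ^t* = 0.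
  rewrite mulmxBl -scalemxAl -rowE; apply/matrixP => a b.
  rewrite !ord1 !mxE conjC1.
  under eq_bigr do rewrite mxE ut mul1r.
  by rewrite sumr_const card_ord mulVf ?subrr.
have w_norm : \sum_y `|w 0 y| ^+ 2 <= 1.
  rewrite -mulmx_trmxC_diag {2}/w linearB linearZ /= map_mxB map_mxZ mulmxBr.
  rewrite -scalemxAr wu scaler0 subr0 trmx_delta map_delta_mx -colE !mxE !eqxx.
  by rewrite mulr1 lerBlDr lerDl invr_ge0 ler0n.
have wA : (w *m A) 0 j = A i j - r / n%:R.
  by rewrite mulmxBl -scalemxAl uA -rowE !mxE mulr1 mulrC.
have := sqnorm_mulmx_le (mu := r ^+ 2) u0 _ wu c0 _ l2.
rewrite mulmxA uA -scalemxAl uAt scalerA => /(_ erefl).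
rewrite ler_sqr ?nnegrE // => /(_ cr) wAw.
rewrite -ler_sqr ?nnegrE // -wA.
apply: (@le_trans _ _ (\sum_y `|(w *m A) 0 y| ^+ 2)).
  by rewrite (bigD1 j) //= lerDl sumr_ge0 // => y _; rewrite exprn_ge0.
by apply: le_trans wAw _; rewrite ler_piMr ?exprn_ge0.
Qed.

End SingularValues.

(** * Entries, row sums and column sums of the matrix of a vertex-transitive graph *)

Section CosetGraph.

Variables (gT : finGroupType) (G : {group gT}) (V : finType) (e : rel V).
Variables (to : action G V) (v : V) (k : nat).
Hypotheses (irr_e : irreflexive e) (val_e : has_valency e k).
Hypothesis trG : [transitive G, on [set: V] | to]%g.

Local Notation S := (neighbour_movers e to v).
Local Notation H := ('C_G[v | to])%g.

(** If [y] is adjacent to [v], every element of [G] sending [v] to [y] lies in [S], and these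
    elements form a right coset of [H]. *)
Lemma edge_multiplicity_base y :
  edge_multiplicity to S v y = if e v y then #|H| else 0.
Proof.
rewrite /edge_multiplicity; case: ifP => vy; last first.
  apply: eq_card0 => s; rewrite !inE.
  by apply/negP => /andP[/andP[_ vs] /eqP ys]; rewrite ys vy in vs.
(* Transitivity presents the vertex set as the orbit of some [x]; the element wanted passes from [v]
   to [y] through [x]. *)
have [a Ga ya] : exists2 a, a \in G & y = to v a.
  have /imsetP[x _ xV] := trG.
  have /orbitP[b Gb <-] : v \in orbit to G x by rewrite -xV inE.
  have /orbitP[a Ga <-] : y \in orbit to G x by rewrite -xV inE.
  by exists (b^-1 * a)%g; rewrite ?groupM ?groupV // actMin ?groupV // actKin.
rewrite -(card_rcoset H a) -(amove_act to v (subxx G) Ga) -ya.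
apply: eq_card => s; rewrite !inE.
by case: eqP => [->|]; rewrite ?andbF // vy !andbT.
Qed.

Lemma sum_edge_multiplicity_r (T : {set gT}) x :
  \sum_y edge_multiplicity to T x y = #|T|.
Proof.
rewrite -sum1_card (partition_big (to x) xpredT) //=.
by apply: eq_bigr => y _; rewrite sum1_card; apply: eq_card => s; rewrite !inE.
Qed.

(** Each [s] in [T] permutes the vertices, so it is counted once, at the preimage of [y]. *)
Lemma sum_edge_multiplicity_l (T : {set gT}) y :
  T \subset G -> \sum_x edge_multiplicity to T x y = #|T|.
Proof.
move=> sTG; rewrite -sum1_card.
rewrite (eq_bigr (fun x => \sum_(s in T) (to x s == y))) => [|x _]; last first.
  rewrite -[LHS]sum1_card big_mkcond [RHS]big_mkcond /=.
  by apply: eq_bigr => s _; rewrite !inE; case: (s \in T); case: eqP.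
rewrite exchange_big /=; apply: eq_bigr => s Ts.
have Gs := subsetP sTG _ Ts.
rewrite (bigD1 (to y s^-1%g)) //= actKVin // eqxx big1 // => x xy.
apply/eqP; rewrite eqb0; apply: contraNneq xy => <-.
by rewrite actKin.
Qed.

Lemma card_neighbour_movers : #|S| = (k * #|H|)%N.
Proof.
rewrite -(sum_edge_multiplicity_r _ v).
under eq_bigr do rewrite edge_multiplicity_base.
rewrite -big_mkcond sum_nat_const -(val_e v).
by congr (_ * _)%N; apply: eq_card => y; rewrite !inE.
Qed.

Lemma valency_lt_order : (k < #|V|)%N.
Proof.
rewrite -(val_e v) -cardsT; apply: proper_card.
by apply/properP; split; [exact: subsetT | exists v; rewrite !inE ?irr_e].
Qed.

Variable C : numClosedFieldType.

Local Open Scope ring_scope.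

Local Notation A := (biadjacency_mx C to S).

Lemma biadjacency_row_sum x : \sum_y A x y = (k * #|H|)%:R.
Proof.
under eq_bigr do rewrite mxE.
rewrite -natr_sum -card_neighbour_movers.
rewrite -(sum_edge_multiplicity_r _ (enum_val x)).
by rewrite [in RHS]big_enum_val.
Qed.

Lemma biadjacency_col_sum y : \sum_x A x y = (k * #|H|)%:R.
Proof.
under eq_bigr do rewrite mxE.
rewrite -natr_sum -card_neighbour_movers.
rewrite -(sum_edge_multiplicity_l (enum_val y)); last first.
  by apply/subsetP => s; rewrite inE => /andP[].
by rewrite [in RHS]big_enum_val.
Qed.

Lemma lambda2_biadjacency_le : lambda2 A <= (k * #|H|)%:R.
Proof.
apply: lambda2_le => [|i]; first exact: ler0n.
apply: spectral_diag_gram_le.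
- by move=> x y; rewrite mxE ler0n.
- exact: biadjacency_row_sum.
- exact: biadjacency_col_sum.
Qed.

Lemma card_stabiliser_le (c : C) :
  (0 < k)%N -> 0 <= c -> lambda2 A < c -> #|H|%:R <= c * k.+1%:R.
Proof.
move=> k0 c0 l2.
have H0 : 0 <= #|H|%:R :> C by exact: ler0n.
(* The mixing inequality needs [c] to be at most the row sum; in the other case [c] already bounds
   [#|H|]. *)
have /orP[cr|rc] : (c <= (k * #|H|)%:R) || ((k * #|H|)%:R <= c).
  by apply: real_leVge; apply: ger0_real; rewrite ?ler0n.
  have [y] : exists y, y \in neighbours e v by apply/card_gt0P; rewrite val_e.
  rewrite inE => vy.
  have := lambda2_mixing (enum_rank v) (enum_rank y) biadjacency_row_sum
    biadjacency_col_sum c0 cr l2.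
  rewrite mxE !enum_rankK edge_multiplicity_base vy natrM => mix.
  have n0 : 0 < #|V|%:R :> C.
    by rewrite ltr0n; apply: leq_ltn_trans valency_lt_order.
  have kn : k.+1%:R <= #|V|%:R :> C by rewrite ler_nat valency_lt_order.
  (* With n = [#|V|], this amounts to n <= (n - k)(k + 1), and the difference of the two sides is
     k(n - (k + 1)) >= 0. *)
  apply: (@le_trans _ _ ((#|H|%:R - k%:R * #|H|%:R / #|V|%:R) * k.+1%:R)).
    rewrite -mulrA (mulrCA k%:R) -[X in X - _]mulr1 -mulrBr -mulrA.
    rewrite ler_peMr // -(ler_pM2r n0) mul1r mulrAC mulrBl mul1r.
    rewrite divfK ?gt_eqF //.
    rewrite -subr_ge0 (_ : _ - _ = k%:R * (#|V|%:R - k.+1%:R)).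
      by rewrite mulr_ge0 ?subr_ge0.
    by rewrite -(natr1 k); ring.
  apply: ler_wpM2r => //; apply: le_trans mix; apply: real_ler_norm.
  by rewrite rpredB ?rpred_div ?rpredM ?realn.
apply: le_trans (_ : (k * #|H|)%:R <= _); first by rewrite ler_nat leq_pmull.
by apply: le_trans rc _; rewrite ler_peMr // ler1n.
Qed.

End CosetGraph.

Theorem theorem1 (C : numClosedFieldType) :
  (forall f : pos_nat -> pos_nat, exists g : pos_nat -> pos_nat,
     forall (k : pos_nat) (V : finType) (e : rel V)
       (gT : finGroupType) (G : {group gT}) (to : action G V) (v : V),
       simple_graph e -> has_valency e k -> acts_vertex_transitively e to ->
       (lambda2 (biadjacency_mx C to (neighbour_movers e to v))
          < (nat_of_pos_nat (f k))%:R)%R ->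
       #|('C_G[v | to])%g| < g k)
  /\
  (forall g : pos_nat -> pos_nat, exists f : pos_nat -> pos_nat,
     forall (k : pos_nat) (V : finType) (e : rel V)
       (gT : finGroupType) (G : {group gT}) (to : action G V) (v : V),
       simple_graph e -> has_valency e k -> acts_vertex_transitively e to ->
       #|('C_G[v | to])%g| < g k ->
       (lambda2 (biadjacency_mx C to (neighbour_movers e to v))
          < (nat_of_pos_nat (f k))%:R)%R).
Proof.
split=> [f | g].
  (* The successor makes the bound strict and the value positive. *)
  exists (fun k : pos_nat => exist _ (f k * k.+1).+1 (ltn0Sn _)).
  move=> k V e gT G to v [_ irr_e] val_e [_ trG] l2 /=.
  rewrite ltnS -(ler_nat C) natrM.
  by apply: (card_stabiliser_le irr_e val_e trG (valP k)) l2; apply: ler0n.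
exists (fun k : pos_nat => exist _ (k * g k).+1 (ltn0Sn _)).
move=> k V e gT G to v _ val_e [_ trG] Hg /=.
apply: le_lt_trans (lambda2_biadjacency_le v val_e trG C) _.
by rewrite ltr_nat ltnS leq_mul2l ltnW ?orbT.
Qed.
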